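(* Let $n\in\{2,3\}$, fix a finite $m$, and let $d_i=\|a_i-x^o\|+r_i$, $i=1,\ldots,m$, where $x^o,a_1,\ldots,a_m\in\mathbb R^n$ are deterministic and the $r_i$ are i.i.d. Gaussian with mean $0$ and finite variance $\sigma^2$. Let $A\in\mathbb R^{m\times(n+1)}$ be the matrix with $i$-th row $[-2a_i^\top\ \ 1]$, assumed to have full column rank, and let $b,\bar b\in\mathbb R^m$ have $i$-th entries $d_i^2-\|a_i\|^2-\sigma^2$ and $d_i^2-\|a_i\|^2$, respectively. Put $\hat y^{\rm BEL}_m=(A^\top A)^{-1}A^\top b$, $\hat y^{\rm NEL}_m=(A^\top A)^{-1}A^\top\bar b$, $\hat x^{\rm BEL}_m=[\hat y^{\rm BEL}_m]_{1:n}$, $\hat x^{\rm NEL}_m=[\hat y^{\rm NEL}_m]_{1:n}$, and $\hat\sigma^{\rm NEL}_m=[\hat y^{\rm NEL}_m]_{n+1}-\|[\hat y^{\rm NEL}_m]_{1:n}\|^2$ (the estimate of $\sigma^2$). Let $y^o=[{x^o}^\top\ \ \|x^o\|^2]^\top$, $\bar y^o=[{x^o}^\top\ \ \|x^o\|^2+\sigma^2]^\top$, $f_j(x^o)=\|a_j-x^o\|$, $\bar A=(A^\top A)^{-1}A^\top$, and $$\Lambda={\rm diag}\left(4f_1^2(x^o)\sigma^2+2\sigma^4,\ldots,4f_m^2(x^o)\sigma^2+2\sigma^4\right).$$ Then: (i) $\hat x^{\rm BEL}_m=\hat x^{\rm NEL}_m$, and $\mathbb E[\hat y^{\rm BEL}_m-y^o]=\mathbb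 E[\hat y^{\rm NEL}_m-\bar y^o]=0$; in particular both estimators of $x^o$ are unbiased. (ii) The mean squared error matrices coincide: $$\mathbb E\left[(\hat y^{\rm BEL}_m-y^o)(\hat y^{\rm BEL}_m-y^o)^\top\right]=\mathbb E\left[(\hat y^{\rm NEL}_m-\bar y^o)(\hat y^{\rm NEL}_m-\bar y^o)^\top\right]=(A^\top A)^{-1}A^\top\Lambda A(A^\top A)^{-1}.$$ (iii) The bias of the noise variance estimate is $$\mathbb E\left[\hat\sigma^{\rm NEL}_m-\sigma^2\right]=-\sum_{i=1}^n\sum_{j=1}^m\bar A_{ij}^2\left(4f_j^2(x^o)\sigma^2+2\sigma^4\right).$$
   Context: $[y]_{1:n}$ denotes the vector of the first $n$ coordinates of $y\in\mathbb R^{n+1}$ and $[y]_{n+1}$ its last coordinate. $\hat y^{\rm BEL}_m$ (Bias-Eli-Lin) and $\hat y^{\rm NEL}_m$ (Noise-Est-Lin) are the minimizers over $\mathbb R^{n+1}$ of $\|Ay-b\|^2$ and $\|Ay-\bar b\|^2$, respectively. *)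

(* Defs.v *)
From HB Require Import structures.
From mathcomp Require Import all_boot all_order all_algebra.
From mathcomp Require Import all_classical all_reals all_analysis.

Set Implicit Arguments.
Unset Strict Implicit.
Unset Printing Implicit Defensive.

Import Order.TTheory GRing.Theory Num.Theory.
Import numFieldNormedType.Exports.
Local Open Scope classical_set_scope.
Local Open Scope ring_scope.

(* Euclidean norm; the norm that MathComp-Analysis puts on matrices, written
   `|x|, is the sup norm. *)
Definition enorm (R : realType) (n : nat) (x : 'cV[R]_n) : R :=
  Num.sqrt (\sum_(i < n) x i ord0 ^+ 2).

(* Normal law with mean mu and standard deviation s; normal_prob mu 0 is the
   uniform law on [0, 1], hence the separate clause for the degenerate case. *)
Definition gaussian_prob (R : realType) (mu s : R) (U : set R) : \bar R :=
  if s == 0 then \d_mu U else normal_prob mu s U.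

Definition mutually_independent (d : measure_display) (T : measurableType d)
    (R : realType) (P : probability T R) (I : finType)
    (X : I -> {RV P >-> R}) : Prop :=
  forall (J : {set I}) (B : I -> set R), (forall i, measurable (B i)) ->
    P (\bigcap_(i in [set` J]) (X i @^-1` B i)) =
    (\prod_(i in J) P (X i @^-1` B i))%E.

Arguments mutually_independent {d T R} P {I} X.

(* Entrywise, in the extended reals. An entry of a measurable X whose
   expectation is a real number is integrable, since oo - oo = -oo. *)
Definition mx_expectation (d : measure_display) (T : measurableType d)
    (R : realType) (P : probability T R) (p q : nat) (X : T -> 'M[R]_(p, q)) :
    'M[\bar R]_(p, q) :=
  \matrix_(i, j) ('E_P[fun w => X w i j])%E.

Definition design_mx (R : realType) (n m : nat) (a : 'I_m -> 'cV[R]_n) :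
    'M[R]_(m, n + 1) :=
  \matrix_(i < m) row_mx (- 2 *: (a i)^T) 1%:M.

Definition lse_mx (R : realType) (m p : nat) (A : 'M[R]_(m, p)) :
    'M[R]_(p, m) :=
  invmx (A^T *m A) *m A^T.

Lemma enorm_sqr (R : realType) (n : nat) (x : 'cV[R]_n) :
  enorm x ^+ 2 = (x^T *m x) ord0 ord0.
Proof.
rewrite sqr_sqrtr; last by apply: sumr_ge0 => i _; exact: sqr_ge0.
by rewrite mxE; apply: eq_bigr => i _; rewrite mxE expr2.
Qed.

Lemma enorm_sqr_eq0 (R : realType) (n : nat) (x : 'cV[R]_n) :
  enorm x ^+ 2 = 0 -> x = 0.
Proof.
rewrite sqr_sqrtr; last by apply: sumr_ge0 => i _; exact: sqr_ge0.
move=> /eqP; rewrite psumr_eq0; last by move=> i _; exact: sqr_ge0.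
move=> /allP x0; apply/matrixP => i j; rewrite ord1 mxE.
by have := x0 i (mem_index_enum i); rewrite /= sqrf_eq0 => /eqP.
Qed.

Lemma enorm_pythagoras (R : realType) (n : nat) (x y : 'cV[R]_n) :
  y^T *m x = 0 -> enorm (x + y) ^+ 2 = enorm x ^+ 2 + enorm y ^+ 2.
Proof.
move=> yx; have xy : x^T *m y = 0 by rewrite -[LHS]trmxK trmx_mul trmxK yx trmx0.
rewrite !enorm_sqr [(x + y)^T]linearD /= mulmxDl !mulmxDr yx xy addr0 add0r.
by rewrite mxE.
Qed.

Lemma gram_unitmx (R : realType) (m p : nat) (A : 'M[R]_(m, p)) :
  \rank A = p -> A^T *m A \in unitmx.
Proof.
move=> rA; rewrite -row_free_unit -kermx_eq0; apply/eqP/row_matrixP => i.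
rewrite row0; set v := row i _.
have vG : v *m (A^T *m A) = 0 by rewrite -row_mul mulmx_ker row0.
have Av : A *m v^T = 0.
  apply: enorm_sqr_eq0; rewrite enorm_sqr trmx_mul trmxK.
  by rewrite -mulmxA [A^T *m _]mulmxA [v *m _]mulmxA vG mul0mx mxE.
have fA : row_free A^T by rewrite -row_leq_rank mxrank_tr rA.
apply: (row_free_inj fA); rewrite mul0mx.
by rewrite -[v]trmxK -trmx_mul Av trmx0.
Qed.

(* lse_mx A *m b is the unique minimizer of y |-> || A y - b ||^2. *)
Lemma lse_minimizer (R : realType) (m p : nat) (A : 'M[R]_(m, p))
    (b : 'cV[R]_m) (y : 'cV[R]_p) : \rank A = p -> y != lse_mx A *m b ->
  enorm (A *m (lse_mx A *m b) - b) ^+ 2 < enorm (A *m y - b) ^+ 2.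
Proof.
move=> rA; set z := lse_mx A *m b => yz.
have uG := gram_unitmx rA.
have normal : A^T *m (A *m z - b) = 0.
  by rewrite mulmxBr mulmxA /z /lse_mx !mulmxA mulmxV// mul1mx subrr.
have -> : A *m y - b = (A *m z - b) + A *m (y - z).
  by rewrite mulmxBr [RHS]addrC addrA subrK.
set e := A *m z - b in normal *; set h := A *m (y - z).
have he : h^T *m e = 0 by rewrite /h trmx_mul -mulmxA normal mulmx0.
rewrite (enorm_pythagoras he) ltrDl lt_neqAle sqr_ge0 andbT eq_sym; apply: contraNneq yz => h0.
have {}h0 := enorm_sqr_eq0 h0.
rewrite -subr_eq0 -[y - z]mul1mx -(mulVmx uG) -!mulmxA -/h h0.
by rewrite !mulmx0.
Qed.

(* Main.v *)
Require Import Defs.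
From HB Require Import structures.
From mathcomp Require Import all_boot all_order all_algebra.
From mathcomp Require Import all_classical all_reals all_analysis.
From mathcomp Require Import measurable_realfun.
From mathcomp Require Import ring lra zify.

Set Implicit Arguments.
Unset Strict Implicit.
Unset Printing Implicit Defensive.

Import Order.TTheory GRing.Theory Num.Theory.
Import numFieldNormedType.Exports.
Local Open Scope classical_set_scope.
Local Open Scope ring_scope.

(* Since d_j^2 = f_j^2 + 2 f_j r_j + r_j^2, both b - A yo and bbar - A ybaro are
   the same noise vector e, with e_j = 2 f_j r_j + r_j^2 - sigma^2; as the least
   squares matrix Abar is a left inverse of A, both estimation errors equal
   Abar e. The first four Gaussian moments give E e_j = 0 and
   E e_j^2 = 4 f_j^2 sigma^2 + 2 sigma^4, and independence makes E e e^T = Lambda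
   diagonal. The estimate of sigma^2 is biased because it contains
   - |xo + v|^2, where v is the position part of Abar e, and E |v|^2 is a partial
   trace of Abar Lambda Abar^T. *)

(** * The centred normal density: derivative, decay and moments on the half-line *)

Section normal_pdf_moments.
Context {R : realType}.
Variables (s : R) (s0 : s != 0).
Notation mu := (@lebesgue_measure R).
Notation phi := (normal_pdf 0 s).

Lemma normal_pdf0N x : phi (- x) = phi x.
Proof. by rewrite normal_pdfE//= /normal_fun !subr0 sqrrN. Qed.

(** Makes [- s ^+ 2] times [phi] an antiderivative of [x * phi x], the factor integrated in the
    integration by parts below. *)
Lemma is_derive_normal_pdf0 (x : R) :
  is_derive x (1 : R) phi (- (x / s ^+ 2) * phi x).
Proof.
pose g : R -> R := (- (s ^+ 2 *+ 2)^-1) \*: ((@id R) ^+ 2).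
have phiE : phi = normal_peak s \*: (expR \o g).
  apply/funext => y; rewrite normal_pdfE//= /normal_fun subr0.
  by congr (_ * expR _); rewrite mulNr mulrC -mulNr.
have dg : is_derive x (1 : R) g (- (x / s ^+ 2)).
  have d2 := is_deriveZ (- (s ^+ 2 *+ 2)^-1) (is_deriveX 2 (is_derive_id x (1 : R))).
  by apply: (is_derive_eq d2); rewrite /GRing.scale/=; field.
have d3 := is_deriveZ (normal_peak s) (is_derive1_comp (is_derive_expR (g x)) dg).
have e : - (x / s ^+ 2) * phi x = normal_peak s *: (expR (g x) * - (x / s ^+ 2)).
  have -> : phi x = normal_peak s * expR (g x) by rewrite phiE.
  by rewrite /GRing.scale/=; ring.
rewrite e; move: d3; rewrite -phiE; exact.
Qed.

(** With y = x^2 / (2 s^2), the bound y^(k+1) / (k+1)! <= exp y makes [phi x] at most C / x^(2k+2).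
    Hence x^k [phi x] <= C / x^(k+2) <= C / x once x >= 1, and [C] collects the constants of this
    bound. *)
Lemma cvg_exprn_normal_pdf0 k : x ^+ k * phi x @[x --> +oo] --> (0 : R).
Proof.
pose C := normal_peak s * (s ^+ 2 *+ 2) ^+ k.+1 * k.+1`!%:R.
have C0 : 0 <= C.
  by rewrite !mulr_ge0// ?normal_peak_ge0// exprn_ge0// mulrn_wge0// sqr_ge0.
apply: (@squeeze_cvgr _ _ _ _ (cst 0) (fun x => C * x^-1)); last 2 first.
- exact: cvg_cst.
- rewrite -[X in _ --> X](mulr0 C); apply: cvgM; first exact: cvg_cst.
  by apply/gtr0_cvgV0; [exact: nbhs_pinfty_gt|exact: cvg_id].
near=> x.
have x1 : 1 <= x by near: x; exact: nbhs_pinfty_ge.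
have x0 : 0 < x by exact: lt_le_trans x1.
rewrite mulr_ge0/= ?normal_pdf_ge0 ?exprn_ge0 ?(ltW x0)//.
have D0 : 0 < s ^+ 2 *+ 2 by rewrite pmulrn_lgt0// exprn_even_gt0.
set D := s ^+ 2 *+ 2 in C C0 D0 *.
have y0 : 0 < x ^+ 2 / D by rewrite divr_gt0// exprn_gt0.
have expy : (x ^+ 2 / D) ^+ k.+1 / k.+1`!%:R <= expR (x ^+ 2 / D).
  by apply: le_trans (expR_ge1Dxn k (ltW y0)); rewrite lerDr.
have phixE : phi x = normal_peak s * (expR (x ^+ 2 / D))^-1.
  by rewrite normal_pdfE// /normal_fun subr0 mulNr expRN.
have f0 : (0 : R) < k.+1`!%:R by rewrite ltr0n fact_gt0.
have yk0 : 0 < (x ^+ 2 / D) ^+ k.+1 / k.+1`!%:R by rewrite divr_gt0// exprn_gt0.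
apply: (@le_trans _ _ (x ^+ k * (normal_peak s *
    ((x ^+ 2 / D) ^+ k.+1 / k.+1`!%:R)^-1))).
  rewrite phixE ler_wpM2l ?exprn_ge0 ?(ltW x0)// ler_wpM2l ?normal_peak_ge0//.
  by rewrite lef_pV2// posrE expR_gt0.
rewrite invf_div expr_div_n invf_div mulrCA (mulrCA (k.+1`!%:R)).
rewrite [leRHS](_ : _ = normal_peak s * (D ^+ k.+1 * k.+1`!%:R * x^-1)); last first.
  by rewrite /C !mulrA.
rewrite ler_wpM2l ?normal_peak_ge0//.
rewrite [leLHS](_ : _ = D ^+ k.+1 * k.+1`!%:R * (x ^+ k.+2)^-1); last first.
  have -> : (x ^+ 2) ^+ k.+1 = x ^+ k * x ^+ k.+2.
    by rewrite -exprM -exprD; congr (_ ^+ _); lia.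
  by field; rewrite !expf_neq0// gt_eqF.
rewrite ler_wpM2l ?mulr_ge0 ?exprn_ge0 ?(ltW D0)//.
by rewrite lef_pV2 ?posrE ?exprn_gt0// ler_eXnr.
Unshelve. all: by end_near. Qed.

(* Integration by parts on [0, n], with a boundary term vanishing as n grows. *)
Lemma half_moment_normal_pdf_rec k :
  (\int[mu]_(x in `[0%R, +oo[) (x ^+ k.+2 * phi x)%:E =
   (k.+1%:R * s ^+ 2)%:E * \int[mu]_(x in `[0%R, +oo[) (x ^+ k * phi x)%:E)%E.
Proof.
have cX j : continuous (fun x : R => x ^+ j * phi x).
  move=> x; apply: cvgM; first exact: exprn_continuous.
  exact: continuous_normal_pdf.
have parts (n : nat) :
  (\int[mu]_(x in `[0%R, n%:R]) (x ^+ k.+2 * phi x)%:E =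
   (- (s ^+ 2 * (n%:R ^+ k.+1 * phi n%:R)))%:E +
   (k.+1%:R * s ^+ 2)%:E * \int[mu]_(x in `[0%R, n%:R]) (x ^+ k * phi x)%:E)%E.
  (* The integration by parts needs a nondegenerate interval; for n = 0 both sides vanish. *)
  have [->|n0] := posnP n.
    by rewrite set_itv1 !integral_set1 expr0n/= mul0r mulr0 mule0 oppr0 adde0.
  have dX (x : R) : is_derive x (1 : R) ((@id R) ^+ k.+1) (k.+1%:R * x ^+ k).
    by apply: is_derive_eq; rewrite /GRing.scale/= mulr1.
  have dG (x : R) : is_derive x (1 : R) ((- s ^+ 2) \*: phi) (x * phi x).
    have ? := is_derive_normal_pdf0 x.
    by apply: is_derive_eq; rewrite /GRing.scale/=; field.
  have LR (f f' : R -> R) : (forall x : R, is_derive x (1 : R) f (f' x)) ->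
      derivable_oo_LRcontinuous f 0 n%:R.
    move=> df; have cf : continuous f.
      by move=> x; apply/differentiable_continuous/derivable1_diffP; case: (df x).
    split => [x _||]; first by case: (df x).
      exact/cvg_at_right_filter/cf.
    exact/cvg_at_left_filter/cf.
  have := @integration_by_parts R ((@id R) ^+ k.+1) ((- s ^+ 2) \*: phi)
    (fun x => k.+1%:R * x ^+ k) (fun x => x * phi x) 0 n%:R.
  rewrite ltr0n => /(_ n0).
  have c1 : continuous (fun x : R => k.+1%:R * x ^+ k).
    by move=> x; apply: cvgM; [exact: cvg_cst|exact: exprn_continuous].
  move=> /(_ (continuous_subspaceT c1) (LR _ _ dX)).
  have D1 : {in `]0, n%:R[, derive1 ((@id R) ^+ k.+1) =1 (fun x => k.+1%:R * x ^+ k)}.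
    by move=> x _; rewrite derive1E; case: (dX x).
  have c2 : continuous (fun x : R => x * phi x) := cX 1%N.
  have D2 : {in `]0, n%:R[, derive1 ((- s ^+ 2) \*: phi) =1 (fun x => x * phi x)}.
    by move=> x _; rewrite derive1E; case: (dG x).
  move=> /(_ D1 (continuous_subspaceT c2) (LR _ _ dG) D2) ibp.
  rewrite -integralZl//=; last first.
    apply: continuous_compact_integrable; first exact: segment_compact.
    exact/continuous_subspaceT/cX.
  transitivity (\int[mu]_(x in `[0%R, n%:R]) (((@id R) ^+ k.+1) x * (x * phi x))%:E)%E.
    apply: eq_integral => x _; congr EFin.
    by rewrite exprfctE mulrA -exprSr.
  rewrite ibp -mulN1e -(@integralZl _ _ _ _ _ _ _ _ (-1))//=; last first.
    apply: continuous_compact_integrable; first exact: segment_compact.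
    apply: continuous_subspaceT => x; apply: cvgM; first exact: c1.
    by apply: cvgM; [exact: cvg_cst|exact: continuous_normal_pdf].
  (* The boundary term at 0 disappears because the exponent [k.+1] is positive. *)
  congr (_ + _)%E.
    by congr EFin; rewrite !exprfctE expr0n /= mul0r subr0 /GRing.scale/= mulrCA mulNr.
  apply: eq_integral => x _.
  rewrite -!EFinM; congr EFin; rewrite /GRing.scale/=; ring.
(* Monotone convergence along the increasing intervals [0, n], on which the integrand is
   nonnegative. *)
have lim j : (\int[mu]_(x in `[0%R, n%:R]) (x ^+ j * phi x)%:E @[n --> \oo] -->
    \int[mu]_(x in `[0%R, +oo[) (x ^+ j * phi x)%:E)%E.
  rewrite itv_bndy_bigcup_BRight.
  have -> : \bigcup_i `[0%R, 0%R + i%:R]%classic = \bigcup_i `[0%R, i%:R]%classic :> set R.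
    by apply: eq_bigcupr => i _; rewrite add0r.
  apply: ge0_nondecreasing_set_cvg_integral => //.
  - apply/nondecreasing_seqP => n; rewrite subsetEset.
    by apply: subset_itvl; rewrite bnd_simp ler_nat.
  - move=> i; apply/measurable_funTS/measurable_EFinP.
    exact: continuous_measurable_fun.
  - move=> i x /=; rewrite in_itv/= => /andP[x0 _].
    by rewrite lee_fin mulr_ge0 ?exprn_ge0 ?normal_pdf_ge0.
(* The left side of [parts] tends to the moment of order k+2, its right side to the claimed multiple
   of the moment of order k; limits are unique. *)
have := lim k.+2; under eq_fun do rewrite parts.
move=> /cvg_unique; apply => //=.
rewrite -[X in _ --> X]add0e.
apply: cvgeD => //.
- apply: cvg_EFin; first exact: nearW.
  rewrite -[X in _ --> X](mulr0 (- s ^+ 2)).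
  under eq_fun do rewrite /= -mulNr.
  apply: cvgM; first exact: cvg_cst.
  have /cvg_pinftyP := @cvg_exprn_normal_pdf0 k.+1; apply.
  exact: cvgr_idn.
- by apply: cvgeZl => //; exact: lim.
Qed.

End normal_pdf_moments.

(** * Calculus of integrable functions with a known real integral *)

Section has_integral.
Context {d : measure_display} {T : measurableType d} {R : realType}.
Variable mu : {measure set T -> \bar R}.
Implicit Types (f g : T -> R) (c e k : R).

(** Integrability travels with the value, so that expectations of polynomials and of matrix products
    are computed by linearity with no side condition left over. *)
Definition has_integral f c : Prop :=
  mu.-integrable setT (EFin \o f) /\ (\int[mu]_x (f x)%:E = c%:E)%E.

Lemma has_integral_ext f g c : f =1 g -> has_integral f c -> has_integral g c.
Proof. by move=> /funext ->. Qed.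

Lemma has_integralD f g c e : has_integral f c -> has_integral g e ->
  has_integral (fun x => f x + g x) (c + e).
Proof.
move=> [fi fc] [gi ge]; split.
  by have := integrableD measurableT fi gi; apply: eq_integrable.
under eq_integral do rewrite EFinD.
by rewrite integralD// fc ge -EFinD.
Qed.

Lemma has_integralZ f c k : has_integral f c ->
  has_integral (fun x => k * f x) (k * c).
Proof.
move=> [fi fc]; split.
  by have := integrableZl measurableT k fi; apply: eq_integrable.
under eq_integral do rewrite EFinM.
by rewrite integralZl// fc -EFinM.
Qed.

Lemma has_integral0 : has_integral (fun=> 0) 0.
Proof. by split; [exact: integrable0|rewrite integral0]. Qed.

Lemma has_integral_sum (I : Type) (r : seq I) (F : I -> T -> R) (C : I -> R) :
  (forall i, has_integral (F i) (C i)) ->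
  has_integral (fun x => \sum_(i <- r) F i x) (\sum_(i <- r) C i).
Proof.
move=> FC; elim: r => [|i r IHr].
  by rewrite big_nil; under eq_fun do rewrite big_nil; exact: has_integral0.
by rewrite big_cons; under eq_fun do rewrite big_cons; exact: has_integralD.
Qed.

Lemma ge0_has_integral f c : measurable_fun setT f -> (forall x, 0 <= f x) ->
  (\int[mu]_x (f x)%:E = c%:E)%E -> has_integral f c.
Proof.
move=> mf f0 fc; split => //; apply/integrableP; split; first exact/measurable_EFinP.
by under eq_integral do rewrite /= ger0_norm//; rewrite fc ltry.
Qed.

End has_integral.

(** Change of variables for the nonnegative function |f| comes first and transfers integrability in
    both directions; the signed formula then applies. Asking [nu] to agree with the image measure on
    measurable sets only lets it be a product measure or a normal law given independently of [X]. *)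
Lemma has_integral_pushforward {d d' : measure_display} {T : measurableType d}
    {T' : measurableType d'} {R : realType} (mu : {measure set T -> \bar R})
    (nu : {measure set T' -> \bar R}) (X : {mfun T >-> T'}) (f : T' -> R) c :
  (forall U, measurable U -> pushforward mu X U = nu U) ->
  measurable_fun setT f ->
  has_integral mu (f \o X) c <-> has_integral nu f c.
Proof.
move=> muX mf.
have mfE : measurable_fun setT (EFin \o f) by exact/measurable_EFinP.
have absE : (\int[nu]_y `|(EFin \o f) y| = \int[mu]_x `|(EFin \o (f \o X)) x|)%E.
  transitivity (\int[pushforward mu X]_y `|(EFin \o f) y|)%E.
    by apply: eq_measure_integral => A mA _; exact/esym/muX.
  by rewrite ge0_integral_pushforward//; exact: measurableT_comp.
have intE : mu.-integrable setT (EFin \o (f \o X)) ->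
    (\int[nu]_y (EFin \o f) y = \int[mu]_x (EFin \o (f \o X)) x)%E.
  move=> fX; transitivity (\int[pushforward mu X]_y (EFin \o f) y)%E.
    by apply: eq_measure_integral => A mA _; exact/esym/muX.
  by rewrite integral_pushforward.
split=> -[/integrableP[mi fi] fc].
  split; last by rewrite -fc intE//; apply/integrableP.
  by apply/integrableP; rewrite absE.
have fX : mu.-integrable setT (EFin \o (f \o X)).
  by apply/integrableP; rewrite -absE; split => //; exact/measurable_EFinP/measurableT_comp.
by split => //; rewrite -fc -intE.
Qed.

Lemma has_integral_norm {d : measure_display} {T : measurableType d} {R : realType}
    (mu : {measure set T -> \bar R}) (f : T -> R) c :
  has_integral mu f c -> exists e, has_integral mu (fun x => `|f x|) e.
Proof.
move=> [fi _].
have nfi : mu.-integrable setT (EFin \o (fun x => `|f x|)) by exact: integrable_abse fi.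
by exists (fine (\int[mu]_x (`|f x|)%:E)); split => //; rewrite fineK// integrable_fin_num.
Qed.

(** * Expectation of a product of two independent variables *)

Section independence.
Context {d : measure_display} {T : measurableType d} {R : realType}.
Variable P : probability T R.

Definition independent2 (X Y : {RV P >-> R}) : Prop :=
  forall A B, measurable A -> measurable B ->
  P (X @^-1` A `&` Y @^-1` B) = (P (X @^-1` A) * P (Y @^-1` B))%E.

(** Independence says that the law of the pair agrees with the product of the two laws on
    rectangles, hence everywhere; the integral of xy against a product measure then splits by
    Fubini. *)
Lemma has_integralM (X Y : {RV P >-> R}) c e : independent2 X Y ->
  has_integral P X c -> has_integral P Y e ->
  has_integral P (fun w => X w * Y w) (c * e).
Proof.
move=> XY [Xi Xc] [Yi Ye].
pose mX := distribution P X; pose mY := distribution P Y.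
have mZ : measurable_fun setT (fun w => (X w, Y w)) by exact: measurable_fun_pair.
pose Z : {mfun T >-> (R * R)%type} := mfun_Sub (mem_set mZ).
have law U : measurable U -> pushforward P Z U = (mX \x mY)%E U.
  move=> mU; symmetry.
  have := @product_measure_unique _ _ _ _ R mX mY (pushforward P Z).
  move=> /(_ mZ); apply => //.
have hX : has_integral mX id c
  by apply/(@has_integral_pushforward _ _ _ _ _ P mX X id c).
have hY : has_integral mY id e
  by apply/(@has_integral_pushforward _ _ _ _ _ P mY Y id e).
have mM : measurable_fun setT (fun z : R * R => z.1 * z.2) by exact: measurable_funM.
apply/(@has_integral_pushforward _ _ _ _ _ P (mX \x mY)%E Z _ _ law mM).
have mME : measurable_fun setT (EFin \o (fun z : R * R => z.1 * z.2)).
  exact/measurable_EFinP.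
(* Tonelli first: the iterated integral of |x||y| is the product of the two finite absolute
   moments. *)
have Zi : (mX \x mY)%E.-integrable setT (EFin \o (fun z : R * R => z.1 * z.2)).
  apply/integrable12ltyP => //.
  have [a hXa] := has_integral_norm hX; have [b hYb] := has_integral_norm hY.
  under eq_integral => x _.
    under eq_integral do rewrite /= normrM.
    rewrite (has_integralZ `|x| hYb).2 mulrC.
    over.
  by rewrite (has_integralZ b hXa).2 ltry.
split => //.
rewrite -integral12_prod_meas1//= /fubini_F.
under eq_integral => x _.
  rewrite /= (has_integralZ x hY).2 mulrC.
  over.
by rewrite (has_integralZ e hX).2 mulrC.
Qed.

End independence.

(** * Integration against the normal law through its density *)

Lemma ge0_integral_normal_prob {R : realType} (m s : R) (f : R -> \bar R) :
  measurable_fun setT f -> (forall x, 0 <= f x)%E ->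
  (\int[normal_prob m s]_x f x = \int[lebesgue_measure]_x (f x * (normal_pdf m s x)%:E))%E.
Proof.
move=> mf f0.
have dom := normal_prob_dominates m s.
(* The integral is taken against the Radon-Nikodym derivative, which equals [normal_pdf m s] almost
   everywhere since both integrate to [normal_prob m s] over every measurable set. *)
rewrite -(Radon_Nikodym_SigmaFinite.change_of_variables dom)//.
apply: ae_eq_integral => //.
- apply: emeasurable_funM => //; apply: (measurable_int (@lebesgue_measure R)).
  exact: Radon_Nikodym_SigmaFinite.f_integrable.
- apply: emeasurable_funM => //; apply/measurable_EFinP.
  exact: measurable_normal_pdf.
- apply: ae_eqe_mul2l; apply: integral_ae_eq => //.
  + exact: Radon_Nikodym_SigmaFinite.f_integrable.
  + by apply/measurable_EFinP; exact: measurable_normal_pdf.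
  + by move=> E _ mE; rewrite -Radon_Nikodym_SigmaFinite.f_integral.
Qed.

Lemma ge0_has_integral_normal_prob {R : realType} (m s : R) (f : R -> R) c :
  measurable_fun setT f -> (forall x, 0 <= f x) ->
  has_integral lebesgue_measure (fun x => f x * normal_pdf m s x) c ->
  has_integral (normal_prob m s) f c.
Proof.
move=> mf f0 [_ fc]; apply: ge0_has_integral => //.
by rewrite ge0_integral_normal_prob//; exact/measurable_EFinP.
Qed.

Lemma has_integral_normal_prob {R : realType} (m s : R) (f : R -> R) c :
  measurable_fun setT f ->
  has_integral lebesgue_measure (fun x => f x * normal_pdf m s x) c ->
  has_integral (normal_prob m s) f c.
Proof.
move=> mf fc; have [e fe] := has_integral_norm fc.
have fe' : has_integral lebesgue_measure (fun x => `|f x| * normal_pdf m s x) e.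
  by apply: has_integral_ext fe => x; rewrite normrM (ger0_norm (normal_pdf_ge0 _ _ _)).
have mnf : measurable_fun setT (fun x => `|f x|) by exact: measurableT_comp.
(* f = (f + |f|) - |f| reduces the claim to nonnegative functions *)
have h1 : has_integral (normal_prob m s) (fun x => f x + `|f x|) (c + e).
  apply: ge0_has_integral_normal_prob.
  - exact: measurable_funD.
  - by move=> x; rewrite -lerBlDr sub0r lerNl -normrN ler_norm.
  - by apply: has_integral_ext (has_integralD fc fe') => x; rewrite mulrDl.
have h2 : has_integral (normal_prob m s) (fun x => `|f x|) e.
  exact: ge0_has_integral_normal_prob.
rewrite -[c](addrK e) -mulN1r.
by apply: has_integral_ext (has_integralD h1 (has_integralZ (-1) h2)) => x; rewrite mulN1r addrK.
Qed.

(** * Gaussian moments up to order four *)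

Section normal_moments.
Context {R : realType}.
Notation mu := (@lebesgue_measure R).

(** Lebesgue measure is invariant under x -> -x, so the integral equals its own opposite. *)
Lemma has_integral_odd (g : R -> R) c :
  measurable_fun setT g -> (forall x, g (- x) = - g x) ->
  has_integral mu g c -> c = 0.
Proof.
move=> mg godd gc.
have mN : measurable_fun setT (-%R : measurableTypeR R -> measurableTypeR R).
  exact: oppr_measurable.
pose N : {mfun measurableTypeR R >-> measurableTypeR R} :=
  @mfun_Sub _ _ (measurableTypeR R) (measurableTypeR R) -%R (mem_set mN).
have gNc : has_integral mu (fun x => g (- x)) c.
  exact: (iffRL (has_integral_pushforward (X := N) c (@lebesgue_measureN R) mg)).
have gNc' : has_integral mu (fun x => g (- x)) (- 1 * c).
  by apply: has_integral_ext (has_integralZ (-1) gc) => x; rewrite mulN1r godd.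
by move: gNc.2; rewrite gNc'.2 => -[?]; lra.
Qed.

Variables (s : R) (s0 : s != 0).
Notation phi := (normal_pdf 0 s).

Let continuous_exprM_pdf k : continuous (fun x : R => x ^+ k * phi x).
Proof.
move=> x; apply: cvgM; first exact: exprn_continuous.
exact: continuous_normal_pdf.
Qed.

(** The integrands are even, so each integral is twice the one over the half-line, where the
    recursion is known. *)
Lemma even_moment_normal_pdf_rec k :
  (\int[mu]_x (x ^+ k.*2.+2 * phi x)%:E =
   (k.*2.+1%:R * s ^+ 2)%:E * \int[mu]_x (x ^+ k.*2 * phi x)%:E)%E.
Proof.
have sym j : (\int[mu]_x (x ^+ j.*2 * phi x)%:E =
    2%:E * \int[mu]_(x in `[0%R, +oo[) (x ^+ j.*2 * phi x)%:E)%E.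
  rewrite ge0_symfun_integralT//.
  - by rewrite set_itvcy.
  - by move=> x; rewrite mulr_ge0 ?normal_pdf_ge0// exprn_even_ge0// odd_double.
  - by move=> x /=; rewrite normal_pdf0N// exprNn -signr_odd odd_double expr0 mul1r.
by rewrite (sym k.+1) sym half_moment_normal_pdf_rec// muleCA.
Qed.

Lemma has_integral_even_normal_pdf k c :
  (\int[mu]_x (x ^+ k.*2 * phi x)%:E = c%:E)%E ->
  has_integral mu (fun x => x ^+ k.*2 * phi x) c.
Proof.
move=> Ec; apply: ge0_has_integral => //.
- by apply: continuous_measurable_fun.
- by move=> x; rewrite mulr_ge0 ?normal_pdf_ge0// exprn_even_ge0// odd_double.
Qed.

(** Orders 2 and 4 follow from the recursion, started at the total mass 1 of the density. Orders 1
    and 3 vanish by oddness, once integrability is known. *)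
Lemma normal_moments :
  [/\ has_integral (normal_prob 0 s) id 0,
      has_integral (normal_prob 0 s) (fun x => x ^+ 2) (s ^+ 2),
      has_integral (normal_prob 0 s) (fun x => x ^+ 3) 0 &
      has_integral (normal_prob 0 s) (fun x => x ^+ 4) (3 * s ^+ 4)].
Proof.
have I0 : (\int[mu]_x (x ^+ 0.*2 * phi x)%:E = 1%:E)%E.
  by rewrite -(integral_normal_pdf 0 s); apply: eq_integral => x _; rewrite mul1r.
have I2 : (\int[mu]_x (x ^+ 1.*2 * phi x)%:E = (s ^+ 2)%:E)%E.
  by rewrite (even_moment_normal_pdf_rec 0) I0 mule1 mul1r.
have I4 : (\int[mu]_x (x ^+ 2.*2 * phi x)%:E = (3 * s ^+ 4)%:E)%E.
  by rewrite (even_moment_normal_pdf_rec 1) I2 -EFinM -mulrA -exprD.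
have H0 := has_integral_even_normal_pdf I0.
have H4 := has_integral_even_normal_pdf I4.
have odd k : odd k -> (k <= 4)%N -> has_integral (normal_prob 0 s) (fun x => x ^+ k) 0.
  move=> ok k4; apply: has_integral_normal_prob; first exact: exprn_measurable.
  have mk : measurable_fun [set: R] (fun x => x ^+ k * phi x).
    by apply: continuous_measurable_fun.
  have ki : mu.-integrable setT (EFin \o (fun x => x ^+ k * phi x)).
    (* For k <= 4, |x|^k <= 1 + x^4: compare with 1 if |x| <= 1 and with x^4 otherwise. *)
    apply: le_integrable (has_integralD H0 H4).1 => //; first exact/measurable_EFinP.
    move=> x _; rewrite /= lee_fin normrM -mulrDl [leRHS]normrM ler_wpM2r//.
    rewrite expr0 normrX [leRHS]ger0_norm; last by rewrite addr_ge0// exprn_even_ge0.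
    rewrite -[x ^+ 2.*2]ger0_norm ?exprn_even_ge0// normrX.
    have [x1|/ltW x1] := lerP `|x| 1.
      by rewrite (@le_trans _ _ 1) ?exprn_ile1// lerDl exprn_ge0.
    by rewrite (@le_trans _ _ (`|x| ^+ 4))// ?ler_weXn2l// lerDr.
  have kc : has_integral mu (fun x => x ^+ k * phi x) (fine (\int[mu]_x (x ^+ k * phi x)%:E)).
    by split => //; rewrite fineK// integrable_fin_num.
  suff k0 : fine (\int[mu]_x (x ^+ k * phi x)%:E) = 0 by rewrite k0 in kc.
  apply: (has_integral_odd mk _ kc) => x.
  by rewrite normal_pdf0N// exprNn -signr_odd ok expr1 mulN1r mulNr.
split; [exact: (odd 1%N)| |exact: odd|].
- by apply: has_integral_normal_prob => //; exact: (has_integral_even_normal_pdf I2).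
- by apply: has_integral_normal_prob.
Qed.

End normal_moments.

Lemma gaussian_rv_moments {d : measure_display} {T : measurableType d} {R : realType}
    (P : probability T R) (X : {RV P >-> R}) (s : R) :
  (forall U, measurable U -> distribution P X U = gaussian_prob 0 s U) ->
  [/\ has_integral P X 0, has_integral P (fun w => X w ^+ 2) (s ^+ 2),
      has_integral P (fun w => X w ^+ 3) 0 &
      has_integral P (fun w => X w ^+ 4) (3 * s ^+ 4)].
Proof.
(* Lebesgue measure and normal_prob live on measurableTypeR R, whose display is
   not the one of R although the measurable sets are the same. *)
have [nu Enu [h1 h2 h3 h4]] : exists2 nu : {measure set (measurableTypeR R) -> \bar R},
    (forall U, measurable U -> gaussian_prob 0 s U = nu U) &
    [/\ has_integral nu id 0, has_integral nu (fun x => x ^+ 2) (s ^+ 2),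
        has_integral nu (fun x => x ^+ 3) 0 &
        has_integral nu (fun x => x ^+ 4) (3 * s ^+ 4)].
  (* For s = 0 the law is the Dirac mass at 0, and the four moments are the values at 0 of the
     powers, all zero as the formulas predict. *)
  have [->|s0] := eqVneq s 0; last first.
    exists (normal_prob 0 s); last exact: normal_moments.
    by move=> U _; rewrite /gaussian_prob (negbTE s0).
  exists (\d_(0 : measurableTypeR R)).
    by move=> U _; rewrite /gaussian_prob eqxx.
  have dirac k : measurable_fun setT k -> has_integral (\d_(0 : measurableTypeR R)) k (k 0 : R).
    move=> mk; have mkE : measurable_fun setT (EFin \o k) by exact/measurable_EFinP.
    split; last by rewrite integral_dirac//= diracT mul1e.
    apply/integrableP; split => //.
    by rewrite integral_dirac ?diracT ?mul1e ?ltry//; exact: measurableT_comp.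
  split.
  - exact: (dirac id).
  - by have := dirac (fun x => x ^+ 2); rewrite expr0n; exact.
  - by have := dirac (fun x => x ^+ 3); rewrite expr0n; exact.
  - by have := dirac (fun x => x ^+ 4); rewrite expr0n mulr0; exact.
move=> gX.
have mX : measurable_fun setT (X : T -> measurableTypeR R)
  by move=> _ U mU; rewrite setTI; exact: (measurable_funPTI X).
pose X' : {mfun T >-> measurableTypeR R} :=
  @mfun_Sub _ _ T (measurableTypeR R) X (mem_set mX).
have law U : measurable U -> pushforward P X' U = nu U.
  by move=> mU; rewrite -Enu// -gX.
have push (f : R -> R) c : measurable_fun setT f -> has_integral nu f c -> has_integral P (f \o X) c.
  by move=> mf; apply: (iffRL (has_integral_pushforward _ law mf)).
split.
- exact: (push id).
- exact: (push (fun x => x ^+ 2)).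
- exact: (push (fun x => x ^+ 3)).
- exact: (push (fun x => x ^+ 4)).
Qed.

(** * Products of functions of two members of an independent family *)

Lemma has_integralM_comp {d : measure_display} {T : measurableType d}
    {R : realType} (P : probability T R) (I : finType) (r : I -> {RV P >-> R})
    (q : I -> R -> R) (i j : I) ci cj :
  mutually_independent P r -> i != j ->
  measurable_fun setT (q i) -> measurable_fun setT (q j) ->
  has_integral P (fun w => q i (r i w)) ci ->
  has_integral P (fun w => q j (r j w)) cj ->
  has_integral P (fun w => q i (r i w) * q j (r j w)) (ci * cj).
Proof.
move=> indep ij mi mj hi hj.
have mX : measurable_fun setT (q i \o r i) by exact: measurableT_comp.
have mY : measurable_fun setT (q j \o r j) by exact: measurableT_comp.
pose X : {RV P >-> R} := @mfun_Sub _ _ T R _ (mem_set mX).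
pose Y : {RV P >-> R} := @mfun_Sub _ _ T R _ (mem_set mY).
apply: (@has_integralM _ _ _ P X Y) => // A B mA mB.
(* Mutual independence is applied to the index set {i, j}. The events of [q i \o r i] and
   [q j \o r j] are events of [r i] and [r j] for the preimages chosen here; j falls in the second
   branch because [i != j]. *)
pose D k := if k == i then q i @^-1` A else q j @^-1` B.
have mD k : measurable (D k).
  by rewrite /D; case: ifP => _; rewrite -[X in measurable X]setTI; [exact: mi|exact: mj].
have := indep [set i; j]%SET D mD.
rewrite big_setU1 ?inE//= big_set1 /D eqxx eq_sym (negbTE ij).
move=> indepE; apply: etrans indepE; congr (P _).
apply/seteqP; split => w /=.
  move=> [Aw Bw] k /=; rewrite !inE => /orP[]/eqP -> /=.
    by rewrite eqxx.
  by rewrite eq_sym (negbTE ij).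
move=> H; split.
  by have := H i; rewrite /= !inE eqxx; apply.
by have := H j; rewrite /= !inE eqxx orbT eq_sym (negbTE ij); apply.
Qed.

(** * Expectations of matrices and least squares algebra *)

Lemma has_integral_cst {d : measure_display} {T : measurableType d} {R : realType}
    (P : probability T R) (c : R) : has_integral P (fun=> c) c.
Proof.
split; first exact: finite_measure_integrable_cst.
by rewrite integral_cst//= probability_setT mule1.
Qed.

Lemma has_integral_mulmxl {d : measure_display} {T : measurableType d} {R : realType}
    (mu : {measure set T -> \bar R}) (p q s : nat) (B : 'M[R]_(p, q))
    (M : T -> 'M[R]_(q, s)) (C : 'M[R]_(q, s)) :
  (forall i j, has_integral mu (fun x => M x i j) (C i j)) ->
  forall i j, has_integral mu (fun x => (B *m M x) i j) ((B *m C) i j).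
Proof.
move=> MC i j; rewrite mxE; under eq_fun do rewrite mxE.
by apply: has_integral_sum => k; exact: has_integralZ.
Qed.

Lemma has_integral_mulmxr {d : measure_display} {T : measurableType d} {R : realType}
    (mu : {measure set T -> \bar R}) (p q s : nat) (B : 'M[R]_(q, s))
    (M : T -> 'M[R]_(p, q)) (C : 'M[R]_(p, q)) :
  (forall i j, has_integral mu (fun x => M x i j) (C i j)) ->
  forall i j, has_integral mu (fun x => (M x *m B) i j) ((C *m B) i j).
Proof.
move=> MC i j; rewrite mxE; under eq_fun do rewrite mxE.
apply: has_integral_sum => k; rewrite mulrC.
by under eq_fun do rewrite mulrC; exact: has_integralZ.
Qed.

Lemma mx_expectationE {d : measure_display} {T : measurableType d} {R : realType}
    (P : probability T R) (p q : nat) (X : T -> 'M[R]_(p, q)) (C : 'M[R]_(p, q)) :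
  (forall i j, has_integral P (fun w => X w i j) (C i j)) ->
  mx_expectation P X = map_mx EFin C.
Proof. by move=> XC; apply/matrixP => i j; rewrite !mxE unlock (XC i j).2. Qed.

Lemma enorm_sqrE {R : realType} {n : nat} (x : 'cV[R]_n) :
  enorm x ^+ 2 = \sum_(i < n) x i ord0 ^+ 2.
Proof. by rewrite sqr_sqrtr// sumr_ge0// => i _; exact: sqr_ge0. Qed.

Lemma enormD_sqr {R : realType} {n : nat} (x y : 'cV[R]_n) :
  enorm (x + y) ^+ 2 =
  enorm x ^+ 2 + 2 * (\sum_(i < n) x i ord0 * y i ord0) + enorm y ^+ 2.
Proof.
rewrite !enorm_sqrE mulr_sumr -!big_split/=; apply: eq_bigr => i _.
by rewrite mxE; ring.
Qed.

Lemma lse_mxK {R : realType} {m p : nat} (A : 'M[R]_(m, p)) :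
  \rank A = p -> lse_mx A *m A = 1%:M.
Proof. by move=> rA; rewrite /lse_mx -mulmxA mulVmx// gram_unitmx. Qed.

(** The Gram matrix is symmetric, hence so is its inverse. This identifies the right-hand factor of
    [MSE] with the transpose of [Abar]. *)
Lemma tr_lse_mx {R : realType} {m p : nat} (A : 'M[R]_(m, p)) :
  (lse_mx A)^T = A *m invmx (A^T *m A).
Proof. by rewrite trmx_mul trmxK trmx_inv trmx_mul trmxK. Qed.

(** The product is -2 <a_i, x> + c, and the inner product is traded for norms by expanding |a_i -
    x|^2. Leaving [c] free covers both [yo] and [ybaro]. *)
Lemma mul_design_mx {R : realType} {n m : nat} (a : 'I_m -> 'cV[R]_n)
    (x : 'cV[R]_n) (c : R) (i : 'I_m) :
  (design_mx a *m col_mx x c%:M) i ord0 =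
  enorm (a i - x) ^+ 2 - enorm (a i) ^+ 2 - enorm x ^+ 2 + c.
Proof.
have -> : (design_mx a *m col_mx x c%:M) i ord0 =
    (row i (design_mx a) *m col_mx x c%:M) ord0 ord0.
  by rewrite !mxE; apply: eq_bigr => k _; rewrite !mxE.
rewrite rowK mul_row_col mul1mx -scalemxAl !mxE eqxx mulr1n.
rewrite enormD_sqr !enorm_sqrE.
have -> : \sum_(k < n) (- x) k ord0 ^+ 2 = \sum_(k < n) x k ord0 ^+ 2.
  by apply: eq_bigr => k _; rewrite mxE sqrrN.
have -> : \sum_(k < n) a i k ord0 * (- x) k ord0 = - \sum_(k < n) (a i)^T ord0 k * x k ord0.
  by rewrite -sumrN; apply: eq_bigr => k _; rewrite !mxE mulrN.
ring.
Qed.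

(** * Mean and variance of the noise in a squared range *)

Section squared_range_noise.
Context {d : measure_display} {T : measurableType d} {R : realType}.
Variables (P : probability T R) (X : {RV P >-> R}) (s : R).
Hypothesis gaussX : forall U, measurable U -> distribution P X U = gaussian_prob 0 s U.
Variable f : R.

Lemma noise_mean : has_integral P (fun w => 2 * f * X w + X w ^+ 2 - s ^+ 2) 0.
Proof.
have [h1 h2 _ _] := gaussian_rv_moments gaussX.
have := has_integralD (has_integralD (has_integralZ (2 * f) h1) h2)
  (has_integral_cst P (- s ^+ 2)).
by rewrite mulr0 add0r subrr.
Qed.

(** The square expands to X^4 + 4f X^3 + (4f^2 - 2s^2) X^2 - 4f s^2 X + s^4. The moments turn this
    into 3s^4 + (4f^2 - 2s^2) s^2 + s^4. *)
Lemma noise_variance :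
  has_integral P (fun w => (2 * f * X w + X w ^+ 2 - s ^+ 2) ^+ 2)
    (4 * f ^+ 2 * s ^+ 2 + 2 * s ^+ 4).
Proof.
have [h1 h2 h3 h4] := gaussian_rv_moments gaussX.
have := has_integralD (has_integralD (has_integralD (has_integralD h4
  (has_integralZ (4 * f) h3)) (has_integralZ (4 * f ^+ 2 - 2 * s ^+ 2) h2))
  (has_integralZ (- (4 * f * s ^+ 2)) h1)) (has_integral_cst P (s ^+ 4)).
rewrite (_ : 3 * s ^+ 4 + _ + _ + _ + _ = 4 * f ^+ 2 * s ^+ 2 + 2 * s ^+ 4); last by ring.
by apply: has_integral_ext => w; ring.
Qed.

End squared_range_noise.

(** * Unbiasedness, mean squared error and bias of the noise variance estimate *)

Theorem mainTheorem6 (R : realType)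
    (disp : measure_display) (Omega : measurableType disp)
    (P : probability Omega R)
    (n m : nat) (hn : n = 2%N \/ n = 3%N)
    (xo : 'cV[R]_n) (a : 'I_m -> 'cV[R]_n)
    (sigma : R) (hsigma : 0 <= sigma)
    (r : 'I_m -> {RV P >-> R})
    (hgauss : forall (i : 'I_m) (U : set R), measurable U ->
       distribution P (r i) U = gaussian_prob 0 sigma U)
    (hindep : mutually_independent P r)
    (hA : \rank (design_mx a) = (n + 1)%N) :
  let A : 'M[R]_(m, n + 1) := design_mx a in
  let d (i : 'I_m) (w : Omega) : R := enorm (a i - xo) + r i w in
  let b (w : Omega) : 'cV[R]_m :=
    \col_i (d i w ^+ 2 - enorm (a i) ^+ 2 - sigma ^+ 2) in
  let bbar (w : Omega) : 'cV[R]_m :=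
    \col_i (d i w ^+ 2 - enorm (a i) ^+ 2) in
  let Abar : 'M[R]_(n + 1, m) := lse_mx A in
  let yBEL (w : Omega) : 'cV[R]_(n + 1) := Abar *m b w in
  let yNEL (w : Omega) : 'cV[R]_(n + 1) := Abar *m bbar w in
  let xBEL (w : Omega) : 'cV[R]_n := usubmx (yBEL w) in
  let xNEL (w : Omega) : 'cV[R]_n := usubmx (yNEL w) in
  let sigmaNEL (w : Omega) : R :=
    dsubmx (yNEL w) ord0 ord0 - enorm (usubmx (yNEL w)) ^+ 2 in
  let yo : 'cV[R]_(n + 1) := col_mx xo (enorm xo ^+ 2)%:M in
  let ybaro : 'cV[R]_(n + 1) := col_mx xo (enorm xo ^+ 2 + sigma ^+ 2)%:M in
  let f (j : 'I_m) : R := enorm (a j - xo) in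
  let Lambda : 'M[R]_m :=
    diag_mx (\row_j (4 * f j ^+ 2 * sigma ^+ 2 + 2 * sigma ^+ 4)) in
  let MSE : 'M[R]_(n + 1) :=
    invmx (A^T *m A) *m A^T *m Lambda *m A *m invmx (A^T *m A) in
  [/\ [/\ (forall w, xBEL w = xNEL w),
          mx_expectation P (fun w => yBEL w - yo) = map_mx EFin 0,
          mx_expectation P (fun w => yNEL w - ybaro) = map_mx EFin 0,
          mx_expectation P xBEL = map_mx EFin xo
        & mx_expectation P xNEL = map_mx EFin xo],
      mx_expectation P (fun w => (yBEL w - yo) *m (yBEL w - yo)^T)
        = map_mx EFin MSE
      /\ mx_expectation P (fun w => (yNEL w - ybaro) *m (yNEL w - ybaro)^T)
        = map_mx EFin MSE
    & ('E_P[fun w => (sigmaNEL w - sigma ^+ 2)%R])%E =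
      (- \sum_(i < n) \sum_(j < m) Abar (lshift 1 i) j ^+ 2 *
           (4 * f j ^+ 2 * sigma ^+ 2 + 2 * sigma ^+ 4))%:E].
Proof.
move=> A d b bbar Abar yBEL yNEL xBEL xNEL sigmaNEL yo ybaro f Lambda MSE.
pose q j x := 2 * f j * x + x ^+ 2 - sigma ^+ 2.
pose e w : 'cV[R]_m := \col_j q j (r j w).
have mq j : measurable_fun setT (q j).
  by apply: measurable_funB => //; exact: measurable_funD.
have mean_e j k : has_integral P (fun w => e w j k) ((0 : 'cV[R]_m) j k).
  rewrite mxE; under eq_fun do rewrite mxE.
  exact: noise_mean (hgauss j) (f j).
have cov_e j k : has_integral P (fun w => (e w *m (e w)^T) j k) (Lambda j k).
  have -> : (fun w => (e w *m (e w)^T) j k) = (fun w => q j (r j w) * q k (r k w)).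
    by apply/funext => w; rewrite mxE big_ord1 !mxE.
  rewrite !mxE; have [<-|jk] := eqVneq j k.
    by rewrite mulr1n; exact: noise_variance (hgauss j) (f j).
  (* Off the diagonal, 0 is written as the product of the two zero means. *)
  rewrite mulr0n -[0](mulr0 0); apply: has_integralM_comp => //.
    exact: noise_mean (hgauss j) (f j).
  exact: noise_mean (hgauss k) (f k).
pose u w := Abar *m e w.
have mean_u i k : has_integral P (fun w => u w i k) 0.
  have := has_integral_mulmxl Abar mean_e i k; rewrite mulmx0 mxE; exact.
have MSE_E : MSE = Abar *m Lambda *m Abar^T by rewrite tr_lse_mx /MSE /Abar /lse_mx !mulmxA.
have cov_u i k : has_integral P (fun w => (u w *m (u w)^T) i k) (MSE i k).
  rewrite MSE_E; have := has_integral_mulmxr Abar^T (has_integral_mulmxl Abar cov_e) i k.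
  by apply: has_integral_ext => w; rewrite /u [(Abar *m e w)^T]trmx_mul !mulmxA.
have AK : Abar *m A = 1%:M by exact: lse_mxK.
(* At [yo] the terms in |xo|^2 cancel and leave f_i^2 - |a_i|^2. At [ybaro] an extra sigma^2
   remains, because the last column of [A] is all ones; it accounts exactly for the sigma^2 that
   [bbar] does not subtract. *)
have bE w : b w = A *m yo + e w.
  apply/colP => i; rewrite [RHS]mxE mul_design_mx !mxE /d /q /f; ring.
have bbarE w : bbar w = A *m ybaro + e w.
  apply/colP => i; rewrite [RHS]mxE mul_design_mx !mxE /d /q /f; ring.
have yBELE w : yBEL w = yo + u w by rewrite /yBEL bE mulmxDr mulmxA AK mul1mx.
have yNELE w : yNEL w = ybaro + u w by rewrite /yNEL bbarE mulmxDr mulmxA AK mul1mx.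
have yBELu w : yBEL w - yo = u w by rewrite yBELE addrC addKr.
have yNELu w : yNEL w - ybaro = u w by rewrite yNELE addrC addKr.
have xBELE w : xBEL w = xo + usubmx (u w).
  by rewrite /xBEL yBELE linearD/= col_mxKu.
have xNELE w : xNEL w = xo + usubmx (u w).
  by rewrite /xNEL yNELE linearD/= col_mxKu.
have mean_x : mx_expectation P (fun w => xo + usubmx (u w)) = map_mx EFin xo.
  apply: mx_expectationE => i k.
  have := has_integralD (has_integral_cst P (xo i k)) (mean_u (lshift 1 i) k).
  by rewrite addr0; apply: has_integral_ext => w; rewrite !mxE.
have mean_u0 : mx_expectation P u = map_mx EFin 0.
  by apply: mx_expectationE => i k; rewrite mxE.
have mean_uu : mx_expectation P (fun w => u w *m (u w)^T) = map_mx EFin MSE.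
  exact: mx_expectationE.
split.
- split.
  + by move=> w; rewrite xBELE xNELE.
  + by rewrite -mean_u0; congr mx_expectation; apply/funext.
  + by rewrite -mean_u0; congr mx_expectation; apply/funext.
  + by rewrite -mean_x; congr mx_expectation; apply/funext.
  + by rewrite -mean_x; congr mx_expectation; apply/funext.
- by split; rewrite -mean_uu; congr mx_expectation; apply/funext => w;
    rewrite ?yBELu ?yNELu.
have MSE_diag i : MSE i i =
    \sum_(j < m) Abar i j ^+ 2 * (4 * f j ^+ 2 * sigma ^+ 2 + 2 * sigma ^+ 4).
  rewrite MSE_E mxE; apply: eq_bigr => j _.
  by rewrite mul_mx_diag !mxE expr2; ring.
(* With v the position part of u, the error of [sigmaNEL] is the last entry of u, minus 2 <xo, v>,
   minus |v|^2. The first two terms are linear in u and have mean zero; |v|^2 is written with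
   diagonal entries of u u^T so that [cov_u] applies. *)
have bias : has_integral P (fun w => u w (rshift n ord0) ord0 +
    ((\sum_(i < n) - (2 * xo i ord0) * u w (lshift 1 i) ord0) +
     -1 * \sum_(i < n) (u w *m (u w)^T) (lshift 1 i) (lshift 1 i)))
  (0 + ((\sum_(i < n) - (2 * xo i ord0) * 0) + -1 * \sum_(i < n) MSE (lshift 1 i) (lshift 1 i))).
  apply: has_integralD => //; apply: has_integralD.
    by apply: has_integral_sum => i; exact: has_integralZ.
  by apply/has_integralZ/has_integral_sum.
rewrite unlock.
(* The target value is put in the unsimplified form that linearity produced in [bias]; what remains
   is a pointwise identity between integrands. *)
have -> : - \sum_(i < n) \sum_(j < m) Abar (lshift 1 i) j ^+ 2 *
    (4 * f j ^+ 2 * sigma ^+ 2 + 2 * sigma ^+ 4) =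
  0 + ((\sum_(i < n) - (2 * xo i ord0) * 0) + -1 * \sum_(i < n) MSE (lshift 1 i) (lshift 1 i)).
  rewrite add0r [X in _ = X + _]big1 ?add0r ?mulN1r; last by move=> i _; rewrite mulr0.
  by congr (- _); apply: eq_bigr => i _; rewrite MSE_diag.
rewrite -bias.2; apply: eq_integral => w _; congr EFin.
rewrite /sigmaNEL -/(xNEL w) xNELE enormD_sqr yNELE linearD/= col_mxKd.
rewrite !mxE eqxx mulr1n.
have -> : \sum_(i < n) xo i ord0 * (usubmx (u w)) i ord0 =
    \sum_(i < n) xo i ord0 * u w (lshift 1 i) ord0.
  by apply: eq_bigr => i _; rewrite [usubmx _ _ _]mxE.
have -> : enorm (usubmx (u w)) ^+ 2 =
    \sum_(i < n) (u w *m (u w)^T) (lshift 1 i) (lshift 1 i).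
  rewrite enorm_sqrE; apply: eq_bigr => i _.
  by rewrite [usubmx _ _ _]mxE [RHS]mxE big_ord1 [_^T _ _]mxE expr2.
have -> : \sum_(i < n) - (2 * xo i ord0) * u w (lshift 1 i) ord0 =
    - (2 * \sum_(i < n) xo i ord0 * u w (lshift 1 i) ord0).
  by rewrite mulr_sumr -sumrN; apply: eq_bigr => i _; rewrite mulNr mulrA.
ring.
Qed.
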